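(* Let $\mathfrak{g}=W(1)$ and $\mathcal{A}=A(1)\otimes_k A(1)$. Then the following identities hold in the Grothendieck group of the category of $\mathfrak{g}$-modules: (1) $[\mathcal{A}]=2[L(0)]+2[L(p-1)]+\sum_{i=1}^{p-2}[L(i)]$; (2) $[L(p-1)\otimes_k L(p-1)]=\sum_{j=0}^{p-2}[L(j)]$.
   Context: $k$ is an algebraically closed field of characteristic $p>3$; all modules are finite-dimensional over $k$. $A(1)=k[X]/(X^p)$ with generator $x=X+(X^p)$; $\mathfrak{g}=W(1)=\mathrm{Der}(A(1))$ is the Witt algebra, a restricted Lie algebra with basis $e_i=x^{i+1}\partial$, $-1\le i\le p-2$, where $\partial=d/dx$, acting naturally on $A(1)$; tensor products carry the usual diagonal Lie algebra action. Let $\mathfrak{b}^+=\mathrm{Span}_k\{e_0,\dots,e_{p-2}\}$ and let $\mathfrak{u}(\cdot)$ denote the restricted enveloping algebra. For $\lambda\in\{0,\dots,p-1\}$ let $k_\lambda$ be the one-dimensional $\mathfrak{b}^+$-module on which $e_0$ acts by $\lambda$ and $e_i$ ($i\ge1$) acts by $0$; put $Z(\lambda)=\mathfrak{u}(\mathfrak{g})\otimes_{\mathfrak{u}(\mathfrak{b}^+)}k_\lambda$, and let $L(\lambda)$ be its unique simple quotient. Explicitly, $Z(\lambda)$ has a basis $m_0,\dots,m_{p-1}$ with $e_k.m_j=(j+k+1+(k+1)\lambda)m_{j+k}$ (with $m_r=0$ for $r\notin\{0,\dots,p-1\}$); $Z(\lambda)$ is simple for $1\le\lambda\le p-2$, $L(0)$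 is the trivial module, and $L(p-1)\cong A(1)/k$ is $(p-1)$-dimensional. For a $\mathfrak{g}$-module $M$, $[M]$ denotes the formal sum of all composition factors of $M$ (with multiplicity) in the Grothendieck group. *)

(* Defs.v *)
From HB Require Import structures.
From mathcomp Require Import all_boot all_order all_algebra ring.
From mathcomp Require Import ring_quotient boolp mxtens freeg.
Set Implicit Arguments.
Unset Strict Implicit.
Unset Printing Implicit Defensive.
Import GRing.Theory.
Local Open Scope ring_scope.
Local Open Scope quotient_scope.

Section WittAlgebra.
Variables (k : closedFieldType) (p : nat).

(* {poly %/ h} silently replaces h by 'X unless h is monic of size > 1, which
   'X^p is as soon as 0 < p. *)
Definition tpoly := {poly %/ ('X^p : {poly k})}.
HB.instance Definition _ := GRing.ComUnitAlgebra.on tpoly.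
HB.instance Definition _ := Vector.on tpoly.

Definition tX : tpoly := in_qpoly 'X^p 'X.

Definition derivation (D : 'End(tpoly)) : Prop :=
  forall a b, D (a * b) = D a * b + a * D b.

Definition derivation_pred : {pred 'End(tpoly)} := fun D => `[< derivation D >].

Lemma derivation_closed : submod_closed derivation_pred.
Proof.
split=> [|a D E /asboolP hD /asboolP hE]; apply/asboolP => u v.
  by rewrite !lfunE /= mul0r mulr0 addr0.
rewrite !add_lfunE !scale_lfunE hD hE mulrDl mulrDr !scalerDr.
by rewrite -!scalerAl -!scalerAr addrACA.
Qed.

HB.instance Definition _ :=
  GRing.isSubmodClosed.Build k 'End(tpoly) derivation_pred derivation_closed.

Record witt : Type := Witt {wval :> 'End(tpoly); _ : wval \in derivation_pred}.
HB.instance Definition _ := [isSub for wval].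
HB.instance Definition _ := [Choice of witt by <:].
HB.instance Definition _ := [SubChoice_isSubLmodule of witt by <:].

Lemma wittP (D : witt) : derivation D.
Proof. exact/asboolP/(valP D). Qed.

Lemma wbracket_subproof (D E : witt) :
  ((D \o E)%VF - (E \o D)%VF : 'End(tpoly)) \in derivation_pred.
Proof.
apply/asboolP => a b; rewrite !add_lfunE !opp_lfunE !comp_lfunE.
rewrite !wittP !linearD /= !wittP mulrBl mulrBr.
have aux (s t u v w z : tpoly) :
  s + t + (u + v) + (- (w + u) - (t + z)) = s - w + (v - z) by ring.
exact: aux.
Qed.

Definition wbracket (D E : witt) : witt := Witt (wbracket_subproof D E).

Hypothesis hp : p \in [pchar k].

Lemma iter_comp_lfunE (D : 'End(tpoly)) n a :
  iter n (comp_lfun D) \1%VF a = iter n D a.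
Proof. by elim: n => [|n IHn] /=; rewrite ?id_lfunE ?comp_lfunE ?IHn. Qed.

Lemma iter_witt0 (D : witt) n : iter n D 0 = 0.
Proof. by elim: n => //= n ->; rewrite linear0. Qed.

Lemma iter_leibniz (D : witt) n a b :
  iter n D (a * b) = \sum_(i < n.+1) iter (n - i) D a * iter i D b *+ 'C(n, i).
Proof.
elim: n => [|n IHn]; first by rewrite big_ord1.
rewrite iterS IHn linear_sum /=.
have step (i : 'I_n.+1) :
    D (iter (n - i) D a * iter i D b *+ 'C(n, i)) =
    iter (n.+1 - i) D a * iter i D b *+ 'C(n, i) +
    iter (n - i) D a * iter i.+1 D b *+ 'C(n, i).
  by rewrite linearMn /= wittP -mulrnDl subSn ?leq_ord.
under eq_bigr => i _ do rewrite step.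
rewrite big_split /= [RHS]big_ord_recl [X in X + _ = _]big_ord_recl.
rewrite !bin0 /= -addrA; congr (_ + _).
under [RHS]eq_bigr => i _ do rewrite binS mulrnDr.
rewrite big_split /=; congr (_ + _).
by rewrite [RHS]big_ord_recr /= bin_small ?mulr0n ?addr0.
Qed.

Lemma wpow_subproof (D : witt) :
  iter p (comp_lfun D) \1%VF \in derivation_pred.
Proof.
have pr := pcharf_prime hp.
apply/asboolP => a b; rewrite !iter_comp_lfunE iter_leibniz.
rewrite big_ord_recl subn0 bin0 mulr1n; congr (_ + _).
case: p pr hp => // q pr hq.
rewrite big_ord_recr /= subnn binn mulr1n big1 ?add0r // => i _.
rewrite -mulr_natr (_ : 'C(_, _)%:R = 0) ?mulr0 //.
apply/eqP; rewrite -(dvdn_pcharf (p := q.+1)) ?pchar_qpoly //.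
by apply: prime_dvd_bin; rewrite //= ltnS ltn_ord.
Qed.

(* The p-th power map of the restricted structure: D^[p] is the p-fold
   composite of D with itself. *)
Definition wpow (D : witt) : witt := Witt (wpow_subproof D).

Definition xpartial_fun (n : nat) (a : tpoly) : tpoly :=
  tX ^+ n * in_qpoly 'X^p (a : {poly k})^`().

Lemma xpartial_is_linear n : linear (xpartial_fun n).
Proof.
move=> c a b; rewrite /xpartial_fun /= derivD derivZ linearP /=.
by rewrite mulrDr scalerAr.
Qed.

HB.instance Definition _ n :=
  GRing.isLinear.Build k tpoly tpoly _ (xpartial_fun n) (@xpartial_is_linear n).

Lemma deriv_mk_monicXp : (mk_monic ('X^p : {poly k}))^`() = 0.
Proof.
have := prime_gt0 (pcharf_prime hp); case: p hp => // q hq _.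
by rewrite mk_monic_Xn derivXn -mulr_natr -polyC_natr (pcharf0 hq) mulr0.
Qed.

Lemma xpartial_subproof n : linfun (xpartial_fun n) \in derivation_pred.
Proof.
apply/asboolP => a b; rewrite !lfunE /= /xpartial_fun.
have valK (c : tpoly) : c = in_qpoly 'X^p (c : {poly k}).
  by apply/val_inj; rewrite /= Pdiv.CommonRing.rmodp_small // size_mk_monic.
suff -> : in_qpoly 'X^p (val (a * b))^`() =
          in_qpoly 'X^p (val a)^`() * b + a * in_qpoly 'X^p (val b)^`() :> tpoly.
  by rewrite mulrDr mulrA mulrCA.
rewrite [X in _ * X + _]valK [X in _ + X * _]valK -!rmorphM -rmorphD /= -derivM.
have hm := monic_mk_monic ('X^p : {poly k}).
rewrite [in RHS](Pdiv.RingMonic.rdivp_eq hm (val a * val b)).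
rewrite derivD [in RHS]derivM deriv_mk_monicXp mulr0 addr0 rmorphD /=.
rewrite [X in _ = X + _](_ : _ = 0) ?add0r //.
by apply/val_inj; rewrite /= Pdiv.RingMonic.rmodp_mull.
Qed.

(* x^n d/dx, that is e_(n-1) in the usual indexing e_i = x^(i+1) d/dx. *)
Definition xpartial n : witt := Witt (xpartial_subproof n).

Lemma xpartialE n a : xpartial n a = tX ^+ n * in_qpoly 'X^p (a : {poly k})^`().
Proof. by rewrite lfunE. Qed.

End WittAlgebra.

Section Modules.
Variables (k : closedFieldType) (p : nat).
Local Notation W := (witt k p).

(* A finite-dimensional left module, on column vectors: D.v = wact D *m v. *)
Record wmod : Type := Wmod {
  wdim : nat;
  wact : W -> 'M[k]_wdim;
  wact_linear : linear wact;
  wact_bracket : forall D E,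
    wact (wbracket D E) = wact D *m wact E - wact E *m wact D
}.

HB.instance Definition _ := gen_eqMixin wmod.
HB.instance Definition _ := gen_choiceMixin wmod.

Definition whom (M N : wmod) (f : 'M[k]_(wdim N, wdim M)) : Prop :=
  forall D, f *m wact M D = wact N D *m f.

Definition mxinj m n (f : 'M[k]_(m, n)) : Prop :=
  forall u v : 'cV_n, f *m u = f *m v -> u = v.

Definition mxsurj m n (f : 'M[k]_(m, n)) : Prop :=
  forall v : 'cV_m, exists u, f *m u = v.

Definition short_exact (M N P : wmod) : Prop :=
  exists (f : 'M_(wdim N, wdim M)) (g : 'M_(wdim P, wdim N)),
  [/\ whom f, whom g, mxinj f, mxsurj g &
      forall v : 'cV_(wdim N), g *m v = 0 <-> exists u, v = f *m u].

(* The transposes turn the left action on columns into a right action on rows,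
   so that the row space of U is a submodule. *)
Definition simple_wmod (M : wmod) : Prop :=
  (0 < wdim M)%N /\
  forall U : 'M_(wdim M), (forall D, stablemx U (wact M D)^T) ->
    U = 0 \/ row_full U.

Definition simple_quotient (M L : wmod) : Prop :=
  simple_wmod L /\ exists f : 'M_(wdim L, wdim M), whom f /\ mxsurj f.

(* The Grothendieck group of finite-dimensional modules: the free abelian group
   on the modules, modulo the subgroup ses_span generated by the N - M - P with
   0 -> M -> N -> P -> 0 exact.  Isomorphic modules get equal classes, and the
   class of a module is the sum of the classes of its composition factors. *)
Inductive ses_span : {freeg wmod} -> Prop :=
| SesSpan0 : ses_span 0
| SesSpanB x y of ses_span x & ses_span y : ses_span (x - y)
| SesSpanG M N P of short_exact M N P : ses_span (<<N>> - <<M>> - <<P>>).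

Definition ses_pred : {pred {freeg wmod}} := fun x => `[< ses_span x >].

Lemma ses_zmod_closed : zmod_closed ses_pred.
Proof.
split=> [|x y /asboolP hx /asboolP hy]; apply/asboolP; first exact: SesSpan0.
exact: SesSpanB.
Qed.

HB.instance Definition _ :=
  GRing.isZmodClosed.Build {freeg wmod} ses_pred ses_zmod_closed.

Definition K0 := Quotient.quot ses_pred.
HB.instance Definition _ := GRing.Zmodule.on K0.

Definition K0_class (M : wmod) : K0 := \pi_K0 <<M>>.

Lemma K0_class_ses M N P :
  short_exact M N P -> K0_class N = K0_class M + K0_class P.
Proof.
move=> sMNP; rewrite /K0_class -[RHS]raddfD /=.
by apply/eqP; rewrite -Quotient.idealrBE opprD addrA; apply/asboolP/SesSpanG.
Qed.

Section Tensor.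
Variables M N : wmod.

Definition tensor_act (D : W) : 'M[k]_(wdim M * wdim N) :=
  wact M D *t 1%:M + 1%:M *t wact N D.

Lemma tensor_act_linear : linear tensor_act.
Proof.
move=> c D E; rewrite /tensor_act !wact_linear.
apply/matrixP => i j; rewrite !mxE.
by ring.
Qed.

Lemma tensor_act_bracket D E : tensor_act (wbracket D E) =
  tensor_act D *m tensor_act E - tensor_act E *m tensor_act D.
Proof.
rewrite /tensor_act !wact_bracket !mulmxDl !mulmxDr !tensmx_mul !mulmx1 !mul1mx.
by apply/matrixP => i j; rewrite !mxE; ring.
Qed.

Definition tensor : wmod := Wmod tensor_act_linear tensor_act_bracket.

End Tensor.

Section Natural.

Definition natural_act (D : W) : 'M[k]_p :=
  \matrix_(i, j) (D (tX k p ^+ j) : {poly k})`_i.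

Lemma natural_act_linear : linear natural_act.
Proof.
move=> c D E; apply/matrixP => i j; rewrite !mxE.
by rewrite add_lfunE scale_lfunE coefD coefZ.
Qed.

Lemma tpoly_sum (a : tpoly k p) : (0 < p)%N ->
  a = \sum_(i < p) (a : {poly k})`_i *: tX k p ^+ i.
Proof.
move=> p0; have mX : mk_monic ('X^p : {poly k}) = 'X^p.
  by move: p0; case: (p) => // q _; rewrite mk_monic_Xn.
have sa : (size (a : {poly k}) <= p)%N.
  by apply: leq_trans (size_npoly a) _; rewrite mX size_polyXn.
transitivity (in_qpoly 'X^p (a : {poly k})).
  by apply/val_inj; rewrite /= Pdiv.CommonRing.rmodp_small // size_mk_monic.
rewrite [X in in_qpoly _ X](_ : _ = \poly_(i < p) (a : {poly k})`_i); last first.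
  apply/polyP => i; rewrite coef_poly; case: ltnP => // pi.
  by rewrite nth_default ?(leq_trans sa).
rewrite poly_def raddf_sum; apply: eq_bigr => i _.
by rewrite /= in_qpolyZ rmorphXn.
Qed.

Lemma natural_act_bracket D E : natural_act (wbracket D E) =
  natural_act D *m natural_act E - natural_act E *m natural_act D.
Proof.
have H (F G : W) (i j : 'I_p) : (F (G (tX k p ^+ j)) : {poly k})`_i =
    (natural_act F *m natural_act G) i j.
  rewrite [X in F X]tpoly_sum ?(leq_ltn_trans _ (ltn_ord i)) //.
  rewrite linear_sum poly_of_qpoly_sum coef_sum mxE; apply: eq_bigr => l _.
  by rewrite linearZ /= coefZ !mxE mulrC.
apply/matrixP => i j; rewrite [LHS]mxE mxE [X in _ = _ + X]mxE -!H.
by rewrite add_lfunE opp_lfunE !comp_lfunE coefB.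
Qed.

(* A(1) with its tautological action, in the basis 1, x, ..., x^(p-1). *)
Definition natural : wmod := Wmod natural_act_linear natural_act_bracket.

End Natural.

Hypothesis hp : p \in [pchar k].

Definition restricted (M : wmod) : Prop :=
  forall D, wact M (wpow hp D) = wact M D ^+ p.

(* v is the image of the generator of k_lambda under a b^+-linear map
   k_lambda -> M; recall that xpartial hp n is e_(n-1). *)
Definition bplus_weight (lambda : nat) (M : wmod) (v : 'cV[k]_(wdim M)) : Prop :=
  wact M (xpartial hp 1) *m v = lambda%:R *: v /\
  forall n, (1 < n < p)%N -> wact M (xpartial hp n) *m v = 0.

(* Z is u(g) (x)_(u(b^+)) k_lambda, through the universal property of extension
   of scalars; u(g)-modules are the restricted g-modules. *)
Definition baby_verma (lambda : nat) (Z : wmod) : Prop :=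
  restricted Z /\ exists2 z : 'cV_(wdim Z), bplus_weight lambda z &
    forall (M : wmod) (v : 'cV_(wdim M)), restricted M -> bplus_weight lambda v ->
      exists! f : 'M_(wdim M, wdim Z), whom f /\ f *m z = v.

End Modules.

(* Main.v *)
Require Import Defs.
From HB Require Import structures.
From mathcomp Require Import all_boot all_order all_algebra.
From mathcomp Require Import boolp mxtens ring.
Set Implicit Arguments.
Unset Strict Implicit.
Unset Printing Implicit Defensive.
Import GRing.Theory.
Local Open Scope ring_scope.

(** The module of tensor densities of weight c is A(1) (dx)^c, where D = f d/dx
acts by the Lie derivative a |-> f a' + c f' a.  Three facts carry the proof.

First, the densities of integral weight are the baby Verma modules: the density
of weight lambda + 1 is restricted ([density_restricted]) and is generated by
x^(p-1), a vector of weight lambda killed by e_1, e_2 and so on.  Following the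
vectors d^i x^(p-1) gives a morphism from it to any restricted module with such
a vector ([density_hom]); applied to Z(lambda), this shows that L(lambda) is a
quotient of the density of weight lambda + 1 ([density_onto_simple]).

Second, the composition factors of these densities can be read off explicitly.
A nonzero submodule contains 1, because d lowers degrees by one, and the e_i
then produce every power of x unless the weight is 0 or 1.  So for lambda
between 1 and p - 2 the density of weight lambda + 1 is L(lambda)
([K0_density_simple]).  For weights 0 and 1, that is for functions and for
1-forms, the constants and the exact forms are submodules, whence the exact
sequences k -> A(1) -> L(p-1) and L(p-1) -> A(1) dx -> L(0), the second one
induced by the exterior derivative ([density0_exact], [density1_exact]).

Third, A(1) (x) A(1) is filtered by the powers of the kernel I of the
multiplication, which is the ideal of the diagonal.  The quotient I^n / I^(n+1)
is spanned over A(1) by the n-th power of 1 (x) x - x (x) 1, hence it is the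
density of weight n.  In formulas, a (x) b |-> a d^n b sends I^n onto the
densities of weight n and commutes with the action up to terms of lower order
([jetmx_act]).  As I^p = 0, the class of A(1) (x) A(1) is the sum of the classes
of the densities of weight 0, ..., p - 1 ([K0_natural_square]).  This is the
first identity, and the second one follows by tensoring k -> A(1) -> L(p-1) on
both sides and cancelling. *)

(** * Derivations of the truncated polynomial ring *)

Section Truncated.
Variables (k : closedFieldType) (p : nat).
Hypothesis hp : p \in [pchar k].
Local Notation A := (tpoly k p).
Local Notation x := (tX k p).
Local Notation W := (witt k p).
Local Notation d := (xpartial hp 0).

Lemma p_gt0 : (0 < p)%N. Proof. exact: prime_gt0 (pcharf_prime hp). Qed.
Lemma p_gt1 : (1 < p)%N. Proof. exact: prime_gt1 (pcharf_prime hp). Qed.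

Lemma mk_monicXp : mk_monic ('X^p : {poly k}) = 'X^p.
Proof. by rewrite mk_monic_Xn prednK ?p_gt0. Qed.

Lemma natr_neq0 n : (0 < n < p)%N -> n%:R != 0 :> k.
Proof.
by rewrite -(dvdn_pcharf hp) => /andP[n0 np]; rewrite gtnNdvd.
Qed.

Lemma fact_neq0 n : (n < p)%N -> n`!%:R != 0 :> k.
Proof.
elim: n => [|n IH] np; first by rewrite oner_eq0.
rewrite factS natrM mulf_neq0 //; last exact/IH/ltnW.
exact: natr_neq0.
Qed.

Lemma size_tpoly (a : A) : (size (a : {poly k}) <= p)%N.
Proof. by rewrite (leq_trans (size_npoly a)) // mk_monicXp size_polyXn. Qed.

Lemma val_in_qpoly (f : {poly k}) : (size f <= p)%N ->
  (in_qpoly 'X^p f : {poly k}) = f.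
Proof. by move=> sf; rewrite in_qpoly_small // mk_monicXp size_polyXn. Qed.

Lemma tX_expE n : x ^+ n = in_qpoly 'X^p 'X^n.
Proof. by rewrite rmorphXn. Qed.

Lemma tX_exp_ge n : (p <= n)%N -> x ^+ n = 0.
Proof.
move=> pn; rewrite tX_expE -(subnK pn) exprD; apply/val_inj => /=.
by rewrite mk_monicXp Pdiv.RingMonic.rmodp_mull // monicXn.
Qed.

Lemma tX_exp_val n : (n < p)%N -> (x ^+ n : {poly k}) = 'X^n.
Proof. by move=> np; rewrite tX_expE val_in_qpoly // size_polyXn. Qed.

Lemma coef_tX n (i : 'I_p) : (x ^+ n : {poly k})`_i = (i == n :> nat)%:R.
Proof.
case: (ltnP n p) => np; first by rewrite tX_exp_val // coefXn.
by rewrite tX_exp_ge // coef0 ltn_eqF // (leq_trans (ltn_ord i)).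
Qed.

Lemma witt_exp (D : W) n a : D (a ^+ n) = (a ^+ n.-1 * D a) *+ n.
Proof.
have D1 : D 1 = 0.
  by apply: (addrI (D 1)); rewrite addr0 -[in RHS](mulr1 1) wittP mulr1 mul1r.
elim: n => [|n IH]; first by rewrite expr0 D1 mulr0n.
rewrite exprS wittP IH; case: n {IH} => [|n].
  by rewrite mulr0 addr0 mulr1 mul1r.
by rewrite /= mulrnAr mulrA -exprS mulrC -mulrS.
Qed.

Lemma witt1 (D : W) : D 1 = 0.
Proof. by rewrite -(expr0 x) witt_exp. Qed.

Lemma xpartial_tX n : xpartial hp n x = x ^+ n.
Proof.
have valx : (x : {poly k}) = 'X by rewrite -(expr1 x) tX_exp_val ?p_gt1.
by rewrite xpartialE valx derivX rmorph1 mulr1.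
Qed.

Lemma partial_tX : d x = 1.
Proof. by rewrite xpartial_tX. Qed.

Lemma partial_exp n : d (x ^+ n) = x ^+ n.-1 *+ n.
Proof. by rewrite witt_exp partial_tX mulr1. Qed.

Lemma partial_val (a : A) : (d a : {poly k}) = (a : {poly k})^`().
Proof.
rewrite xpartialE mul1r val_in_qpoly // (leq_trans _ (size_tpoly a)) //.
exact: leq_trans (size_poly _ _) (leq_pred _).
Qed.

(** For a linear map, testing on the first p powers of x is enough; this is how
all operator identities below are reduced to monomials. *)
Lemma tpoly_linear_ext (V : lmodType k) (F G : {linear A -> V}) :
  (forall i, (i < p)%N -> F (x ^+ i) = G (x ^+ i)) -> F =1 G.
Proof.
move=> FG a; rewrite (tpoly_sum a) ?p_gt0 // !linear_sum.
by apply: eq_bigr => i _; rewrite !linearZ /= FG.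
Qed.

(** Leibniz' rule computes D on powers of x from D x; in other words the Witt
algebra is free over the truncated polynomials with basis d/dx. *)
Lemma wittE (D : W) a : D a = D x * d a.
Proof.
apply: (@tpoly_linear_ext _ (wval D) (D x \*o wval d)) => i _.
rewrite -[LHS]/(D (x ^+ i)) -[RHS]/(D x * d (x ^+ i)) !witt_exp.
by rewrite partial_tX mulr1 mulrnAr mulrC.
Qed.

Lemma witt_eq (D E : W) : D x = E x -> D = E.
Proof.
by move=> DE; apply/val_inj/lfunP => a; rewrite [LHS]wittE [RHS]wittE DE.
Qed.

(** The derivations e_(-1), ..., e_(p-2) form a basis, so that equivariance only
has to be tested on them. *)
Lemma witt_sum (D : W) :
  D = \sum_(i < p) (D x : {poly k})`_i *: xpartial hp i.
Proof.
apply: witt_eq; rewrite [LHS](tpoly_sum (D x)) ?p_gt0 //.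
pose ev (E : W) := wval E x.
have ev_lin : linear ev by move=> c E F; rewrite /ev /= add_lfunE scale_lfunE.
pose evL : {linear W -> A} :=
  HB.pack ev (GRing.isLinear.Build _ _ _ _ ev ev_lin).
rewrite -[RHS]/(evL _) linear_sum; apply: eq_bigr => i _.
by rewrite linearZZ; congr (_ *: _); exact/esym/xpartial_tX.
Qed.

(** A derivation is determined by its value at x, and d^p x = 0 as p > 1. *)
Lemma wpow_partial : wpow hp d = 0.
Proof.
apply: witt_eq; rewrite lfunE /= iter_comp_lfunE.
rewrite -[X in iter X _ _](subnK p_gt1) iterD.
rewrite -[iter 2 _ _]/(d (d x)) partial_tX witt1; exact: (iter_witt0 d).
Qed.

Lemma bracket_partial n :
  wbracket (xpartial hp n) d = - (n%:R *: xpartial hp n.-1).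
Proof.
apply: witt_eq.
have -> : (- (n%:R *: xpartial hp n.-1) : W) x = - (n%:R *: xpartial hp n.-1 x).
  by rewrite opp_lfunE scale_lfunE.
rewrite add_lfunE opp_lfunE !comp_lfunE partial_tX witt1 !xpartial_tX.
by rewrite partial_exp scaler_nat sub0r.
Qed.

End Truncated.

(** * Coordinates on the truncated polynomial ring *)

Section Coordinates.
Variables (k : closedFieldType) (p : nat).
Hypothesis hp : p \in [pchar k].
Local Notation A := (tpoly k p).
Local Notation x := (tX k p).

Definition cvec (a : A) : 'cV[k]_p := \col_i (a : {poly k})`_i.

Lemma cvec_is_linear : linear cvec.
Proof. by move=> c a b; apply/colP => i; rewrite !mxE coefD coefZ. Qed.

HB.instance Definition _ :=
  GRing.isLinear.Build k A 'cV[k]_p _ cvec cvec_is_linear.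

Definition tpoly_of_cvec (v : 'cV[k]_p) : A := \sum_i v i 0 *: x ^+ i.

Lemma cvec_tX j (i : 'I_p) : cvec (x ^+ j) i 0 = (i == j :> nat)%:R.
Proof. by rewrite mxE coef_tX. Qed.

Lemma cvecK : cancel cvec tpoly_of_cvec.
Proof.
move=> a; rewrite [RHS](tpoly_sum a) ?(p_gt0 hp) //.
by apply: eq_bigr => i _; rewrite mxE.
Qed.

Lemma tpoly_of_cvecK : cancel tpoly_of_cvec cvec.
Proof.
move=> v; apply/colP => i; rewrite linear_sum summxE (bigD1 i) //= linearZ /=.
rewrite mxE cvec_tX eqxx mulr1 big1 ?addr0 // => j ji.
by rewrite linearZ /= mxE cvec_tX eq_sym -[_ == _]/(j == i) (negPf ji) mulr0.
Qed.

Lemma cvec_eq0 a : cvec a = 0 -> a = 0.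
Proof. by move=> a0; apply: (can_inj cvecK); rewrite a0 linear0. Qed.

Lemma cvec_delta (j : 'I_p) : delta_mx j 0 = cvec (x ^+ j).
Proof.
by apply/colP => i; rewrite cvec_tX mxE eqxx andbT.
Qed.

Lemma cvec_ext m (B C : 'M[k]_(m, p)) :
  (forall j, (j < p)%N -> B *m cvec (x ^+ j) = C *m cvec (x ^+ j)) -> B = C.
Proof.
move=> BC; apply/matrixP => i j.
by have /colP/(_ i) := BC _ (ltn_ord j); rewrite -cvec_delta -!colE !mxE.
Qed.

(** The matrix of F in the basis 1, x, ..., x^(p-1) when F is linear. It is
defined for any function, so that composites and iterates need no linear
structure. *)
Definition opmx (F : A -> A) : 'M[k]_p :=
  \matrix_(i, j) (F (x ^+ j) : {poly k})`_i.

Lemma opmx_tX F j : (j < p)%N -> opmx F *m cvec (x ^+ j) = cvec (F (x ^+ j)).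
Proof.
move=> jp; rewrite -(cvec_delta (Ordinal jp)) -colE.
by apply/colP => i; rewrite !mxE.
Qed.

Lemma opmx_cvec (F : {linear A -> A}) a : opmx F *m cvec a = cvec (F a).
Proof.
apply: (tpoly_linear_ext hp (F := mulmx (opmx F) \o cvec) (G := cvec \o F)).
by move=> j jp; exact: opmx_tX.
Qed.

Lemma opmx_comp (F : {linear A -> A}) (G : A -> A) :
  opmx F *m opmx G = opmx (F \o G).
Proof.
by apply: cvec_ext => j jp; rewrite -mulmxA !opmx_tX // opmx_cvec.
Qed.

Lemma opmx_exp (F : {linear A -> A}) n : opmx F ^+ n = opmx (iter n F).
Proof.
elim: n => [|n IH]; last by rewrite exprS IH; exact: opmx_comp.
by apply: cvec_ext => j jp; rewrite expr0 mul1mx opmx_tX.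
Qed.

Lemma eq_opmx (F G : A -> A) : F =1 G -> opmx F = opmx G.
Proof. by move=> FG; apply/matrixP => i j; rewrite !mxE FG. Qed.

End Coordinates.

(** * Tensor density modules *)

(** In Leibniz' formula for the p-th iterate, all the binomial coefficients but
the two extreme ones vanish. Three operators are allowed since the densities of
the two factors and of their product have different weights. *)
Lemma iter_leibniz_pchar (R : comNzRingType) p
    (D1 D2 D3 : {additive R -> R}) a b :
    p \in [pchar R] ->
    (forall a b, D3 (a * b) = D1 a * b + a * D2 b) ->
  iter p D3 (a * b) = iter p D1 a * b + a * iter p D2 b.
Proof.
move=> pR D123.
have leibniz n : iter n D3 (a * b) =
    \sum_(i < n.+1) iter (n - i) D1 a * iter i D2 b *+ 'C(n, i).
  elim: n => [|n IHn]; first by rewrite big_ord1.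
  rewrite iterS IHn raddf_sum /=.
  under eq_bigr => i _.
    rewrite raddfMn D123 -!iterS -subSn ?leq_ord // mulrnDl; over.
  rewrite big_split /= [RHS]big_ord_recl [X in X + _ = _]big_ord_recl.
  rewrite !bin0 /= -addrA; congr (_ + _).
  under [RHS]eq_bigr => i _ do rewrite binS mulrnDr.
  rewrite big_split /= [X in _ = X + _]big_ord_recr /=.
  by rewrite bin_small // mulr0n addr0.
have pr := pcharf_prime pR; rewrite leibniz big_ord_recl subn0 bin0 mulr1n.
congr (_ + _); case: p pr pR => // q pr hq.
rewrite big_ord_recr /= subnn binn mulr1n big1 ?add0r // => i _.
rewrite -mulr_natr (_ : 'C(_, _)%:R = 0) ?mulr0 //.
apply/eqP; rewrite -(dvdn_pcharf (p := q.+1)) //.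
by apply: prime_dvd_bin; rewrite //= ltnS ltn_ord.
Qed.

Section Density.
Variables (k : closedFieldType) (p : nat).
Hypothesis hp : p \in [pchar k].
Local Notation A := (tpoly k p).
Local Notation x := (tX k p).
Local Notation W := (witt k p).
Local Notation d := (xpartial hp 0).

Lemma wittB (D : W) a b : D (a - b) = D a - D b. Proof. exact: linearB. Qed.
Lemma wittD (D : W) a b : D (a + b) = D a + D b. Proof. exact: linearD. Qed.
Lemma wittZ (D : W) c a : D (c *: a) = c *: D a. Proof. exact: linearZZ. Qed.

(** The Lie derivative of a (dx)^c along D: if D = f d/dx then d (D x) = f' is
the divergence of D. *)
Definition dens (c : k) (D : W) (a : A) : A := D a + c *: (d (D x) * a).

Lemma dens_is_linear c D : linear (dens c D).
Proof.
move=> e a b; rewrite /dens linearP mulrDr -scalerAr scalerDr.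
by rewrite [in LHS]scalerA [c * e]mulrC -scalerA [in RHS]scalerDr addrACA.
Qed.

HB.instance Definition _ c D :=
  GRing.isLinear.Build k A A _ (dens c D) (dens_is_linear c D).

Lemma dens0 (D : W) : dens 0 D =1 D.
Proof. by move=> a; rewrite /dens scale0r addr0. Qed.

(** Weights add up when densities are multiplied. *)
Lemma densM c e D a b :
  dens (c + e) D (a * b) = dens c D a * b + a * dens e D b.
Proof.
rewrite /dens wittP mulrDl mulrDr -!scalerAl -!scalerAr scalerDl.
by rewrite mulrA [a * (_ * b)]mulrCA mulrA addrACA.
Qed.

(** The exterior derivative, from functions to 1-forms, is invariant. *)
Lemma dens_partial (D : W) a : d (D a) = dens 1 D (d a).
Proof.
by rewrite /dens scale1r (wittE hp D a) (wittE hp D (d a)) wittP addrC.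
Qed.

Lemma dens_act_linear c : linear (fun D : W => opmx (dens c D)).
Proof.
move=> e D E; apply/matrixP => i j; rewrite !mxE -coefZ -coefD.
suff -> : dens c (e *: D + E) (x ^+ j) =
          e *: dens c D (x ^+ j) + dens c E (x ^+ j) by [].
rewrite /dens !add_lfunE !scale_lfunE linearP mulrDl -scalerAl !scalerDr.
by rewrite !scalerA [c * e]mulrC addrACA.
Qed.

Lemma dens_bracket c D E a :
  dens c (wbracket D E) a = dens c D (dens c E a) - dens c E (dens c D a).
Proof.
have DE b : wbracket D E b = D (E b) - E (D b).
  by rewrite add_lfunE opp_lfunE !comp_lfunE.
have [C cE] : exists C : A, forall z, c *: z = C * z.
  by exists c%:A => z; rewrite mulr_algl.
have dDE : d (wbracket D E x) = D (d (E x)) - E (d (D x)).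
  rewrite DE wittB (dens_partial D (E x)) (dens_partial E (D x)) /dens !scale1r.
  by rewrite [d (D x) * _]mulrC opprD addrACA subrr addr0.
rewrite {1}/dens dDE DE /dens !wittD !wittZ !wittP !cE.
by ring.
Qed.

Lemma dens_act_bracket c D E : opmx (dens c (wbracket D E)) =
  opmx (dens c D) *m opmx (dens c E) - opmx (dens c E) *m opmx (dens c D).
Proof.
apply: (cvec_ext hp) => j jp; rewrite mulmxBl !opmx_comp // !opmx_tX //=.
by rewrite dens_bracket linearB.
Qed.

Definition density (c : k) : wmod k p :=
  Wmod (dens_act_linear c) (dens_act_bracket c).

(** Multiplicativity reduces the weight n + 1 to the weights 1 and n, and leaves
only the value at 1 of the p-th power in weight 1 to be computed. There 1 is the
exact form d x, and d commutes with the action. *)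
Lemma dens_iter_pchar n D : iter p (dens n%:R D) =1 dens n%:R (wpow hp D).
Proof.
have wpowE b : wpow hp D b = iter p D b by exact: iter_comp_lfunE.
elim: n => [|n IH] a.
  by rewrite dens0 wpowE; apply: eq_iter; exact: dens0.
have d1 : iter p (dens 1 D) 1 = d (wpow hp D x).
  rewrite wpowE -(partial_tX hp).
  suff H m : iter m (dens 1 D) (d x) = d (iter m D x) by exact: H.
  by elim: m => //= m ->; rewrite dens_partial.
rewrite -[a in LHS]mul1r (@iter_leibniz_pchar _ _ (dens 1 D) (dens n%:R D)).
- by rewrite d1 mul1r IH /dens -nat1r scalerDl scale1r addrCA.
- by rewrite pchar_qpoly.
- by move=> b e; rewrite -densM nat1r.
Qed.

Lemma density_restricted n : restricted hp (density n%:R).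
Proof.
move=> D; rewrite /= opmx_exp //.
by apply: eq_opmx => a; rewrite dens_iter_pchar.
Qed.

End Density.

(** * Linear algebra on column vectors *)

Section Matrices.
Variable k : closedFieldType.

Lemma mxinjP m n (f : 'M[k]_(m, n)) : mxinj f <-> exists r, r *m f = 1%:M.
Proof.
split=> [inj|[r rf] u v fuv]; last first.
  by rewrite -[u]mul1mx -[v]mul1mx -rf -!mulmxA fuv.
suff /row_fullP : row_full f by [].
rewrite /row_full -mxrank_tr -/(row_free _) -kermx_eq0.
apply/eqP/row_matrixP => i.
rewrite row0 -[LHS]trmxK (inj (row i (kermx f^T))^T 0) ?trmx0 // mulmx0.
by rewrite -{1}[f]trmxK -trmx_mul -row_mul mulmx_ker row0 trmx0.
Qed.

Lemma mxsurjP m n (f : 'M[k]_(m, n)) : mxsurj f <-> exists s, f *m s = 1%:M.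
Proof.
split=> [sur|[s fs] v]; last by exists (s *m v); rewrite mulmxA fs mul1mx.
have [h hP] := choice (fun j => sur (delta_mx j 0)).
exists (\matrix_(i, j) h j i 0); apply/matrixP => i j.
have /colP/(_ i) := hP j; rewrite !mxE eqxx andbT eq_sym => <-.
by apply: eq_bigr => l _; rewrite mxE.
Qed.

Lemma mxsurj_rank m n (f : 'M[k]_(m, n)) : mxsurj f <-> \rank f = m.
Proof.
split=> [/mxsurjP/row_freeP/eqP//|/eqP fm].
exact/mxsurjP/row_freeP.
Qed.

Lemma mxinj_ker0 m n (f : 'M[k]_(m, n)) :
  (forall v : 'cV_n, f *m v = 0 -> v = 0) -> mxinj f.
Proof.
move=> f0 u v fuv; apply/eqP; rewrite -subr_eq0; apply/eqP/f0.
by rewrite mulmxBr fuv subrr.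
Qed.

Lemma tensmx11 m n : (1%:M : 'M[k]_m) *t (1%:M : 'M[k]_n) = 1%:M.
Proof.
apply/matrixP => i j; case: (mxtens_indexP i) => i0 i1.
case: (mxtens_indexP j) => j0 j1; rewrite tensmxE !mxE -natrM mulnb.
by rewrite (inj_eq (can_inj (@mxtens_indexK _ _))).
Qed.

Lemma tensmxDl m n q r (B C : 'M[k]_(m, n)) (D : 'M_(q, r)) :
  (B + C) *t D = B *t D + C *t D.
Proof. by apply/matrixP => i j; rewrite !mxE mulrDl. Qed.

Lemma tensmxDr m n q r (B C : 'M[k]_(m, n)) (D : 'M_(q, r)) :
  D *t (B + C) = D *t B + D *t C.
Proof. by apply/matrixP => i j; rewrite !mxE mulrDr. Qed.

Lemma col_mulmx m n q (B : 'M[k]_(m, n)) (C : 'M_(n, q)) j :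
  col j (B *m C) = B *m col j C.
Proof. by rewrite !colE mulmxA. Qed.

(** Exactness is stated on vectors; this turns it into a factorization of
matrices, with the factor given by any left inverse t of f. *)
Lemma exact_factor m n q r
    (f : 'M[k]_(m, n)) (g : 'M_(q, m)) t (B : 'M_(m, r)) :
    (forall v : 'cV_m, g *m v = 0 -> exists u, v = f *m u) ->
  t *m f = 1%:M -> g *m B = 0 -> B = f *m (t *m B).
Proof.
move=> gf tf gB; apply/matrixP => i j.
have [u Bu] : exists u, col j B = f *m u.
  by apply: gf; rewrite -col_mulmx gB linear0.
suff /colP/(_ i) : col j B = col j (f *m (t *m B)) by rewrite !mxE.
by rewrite !col_mulmx Bu [t *m _]mulmxA tf mul1mx.
Qed.

Lemma kernel_basis m n (f : 'M[k]_(m, n)) :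
  exists r (i : 'M_(n, r)) t,
  [/\ t *m i = 1%:M, f *m i = 0, r = (n - \rank f)%N &
      forall v : 'cV_n, f *m v = 0 -> exists u, v = i *m u].
Proof.
have /row_freeP [t tK] := row_base_free (kermx f^T).
exists _, (row_base (kermx f^T))^T, t^T; split.
- by rewrite -trmx_mul tK trmx1.
- apply/trmx_inj; rewrite trmx_mul trmxK trmx0; apply/sub_kermxP.
  by rewrite eq_row_base.
- by rewrite mxrank_ker mxrank_tr.
move=> v fv; have /submxP [u uP] : (v^T <= row_base (kermx f^T))%MS.
  by rewrite eq_row_base; apply/sub_kermxP; rewrite -trmx_mul fv trmx0.
by exists u^T; rewrite -[v]trmxK uP trmx_mul.
Qed.

End Matrices.

(** * Modules and their classes in the Grothendieck group *)

Section Modules.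
Variables (k : closedFieldType) (p : nat).
Local Notation W := (witt k p).
Implicit Types M N P L : wmod k p.

HB.instance Definition _ M :=
  GRing.isLinear.Build k W 'M[k]_(wdim M) _ (@wact k p M) (@wact_linear k p M).

Lemma whom_mul M N P (f : 'M_(wdim N, wdim M)) (g : 'M_(wdim P, wdim N)) :
  whom f -> whom g -> @whom k p M P (g *m f).
Proof. by move=> hf hg D; rewrite -mulmxA hf mulmxA hg mulmxA. Qed.

Lemma whom1 M : @whom k p M M 1%:M.
Proof. by move=> D; rewrite mul1mx mulmx1. Qed.

(** The image of a morphism is a submodule. *)
Lemma simple_hom M L (f : 'M_(wdim L, wdim M)) :
  simple_wmod L -> whom f -> f = 0 \/ mxsurj f.
Proof.
case=> _ simL hf.
have [D|U0|fullU] := simL <<f^T>>%MS.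
- rewrite (eqmxMr _ (genmxE _)) genmxE -trmx_mul -hf trmx_mul.
  exact: submxMl.
- left; apply/trmx_inj; rewrite trmx0; apply/eqP.
  by rewrite -submx0 -genmxE U0.
right; apply/mxsurj_rank; rewrite -mxrank_tr; apply/eqP.
by have := fullU; rewrite /row_full genmxE.
Qed.

(** A module lives on a coordinate space, so a submodule is given by a basis i
of it, and its action is read off through a left inverse of i. *)
Lemma kernel_exists M n (f : 'M_(n, wdim M)) :
    (forall D v, f *m v = 0 :> 'cV_n -> f *m (wact M D *m v) = 0) ->
  exists (K : wmod k p) (i : 'M_(wdim M, wdim K)),
    [/\ whom i, mxinj i,
        forall v : 'cV_(wdim M), f *m v = 0 <-> exists u, v = i *m u
      & wdim K = (wdim M - \rank f)%N].
Proof.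
move=> stab; have [m [i [r [ri fi dm exact_i]]]] := kernel_basis f.
have [a aE] : exists a : W -> 'M_m, forall D, wact M D *m i = i *m a D.
  exists (fun D => r *m (wact M D *m i)) => D.
  apply: (exact_factor exact_i ri); apply/matrixP => s j.
  suff /colP/(_ s) : col j (f *m (wact M D *m i)) = 0 by rewrite !mxE.
  by rewrite !col_mulmx stab // -col_mulmx fi linear0.
have inj_i D C : wact M D *m i = i *m C -> a D = C.
  by rewrite aE => /(congr1 (mulmx r)); rewrite !mulmxA ri !mul1mx.
have a_lin : linear a.
  move=> c D E; apply: inj_i; rewrite wact_linear mulmxDl mulmxDr -scalemxAl.
  by rewrite -scalemxAr !aE.
have aaE D E : wact M D *m wact M E *m i = i *m (a D *m a E).
  by rewrite -mulmxA aE mulmxA aE mulmxA.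
have a_bra D E : a (wbracket D E) = a D *m a E - a E *m a D.
  by apply: inj_i; rewrite wact_bracket mulmxBl mulmxBr !aaE.
exists (Wmod a_lin a_bra), i; split=> //=.
- by apply/mxinjP; exists r.
by move=> v; split=> [/exact_i//|[u ->]]; rewrite mulmxA fi mul0mx.
Qed.

Lemma kernel_ses M N (f : 'M_(wdim N, wdim M)) : whom f -> mxsurj f ->
  exists (K : wmod k p) (i : 'M_(wdim M, wdim K)),
    [/\ whom i, mxinj i,
        forall v : 'cV_(wdim M), f *m v = 0 <-> exists u, v = i *m u,
        wdim K = (wdim M - wdim N)%N & K0_class M = K0_class K + K0_class N].
Proof.
move=> hf sf.
have [D v fv|K [i [hi ji exi dK]]] := @kernel_exists M _ f.
  by rewrite mulmxA hf -mulmxA fv mulmx0.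
exists K, i; split=> //; first by rewrite dK (mxsurj_rank f).1.
by apply: K0_class_ses; exists i, f; split.
Qed.

Lemma K0_dim0 M : wdim M = 0%N -> K0_class M = 0.
Proof.
move=> M0; have all0 (u v : 'cV_(wdim M)) : u = v.
  by apply/colP => i; have := ltn_ord i; rewrite {2}M0.
have /K0_class_ses/eqP : short_exact M M M.
  exists 0, 0; split=> // [D|D|v|v]; rewrite ?mul0mx ?mulmx0 //.
    by exists v; exact: all0.
  by split=> // _; exists v; exact: all0.
by rewrite -subr_eq0 opprD addNKr oppr_eq0 => /eqP.
Qed.

Lemma K0_iso M N (f : 'M_(wdim N, wdim M)) :
  whom f -> mxinj f -> mxsurj f -> K0_class M = K0_class N.
Proof.
move=> hf jf sf; have [K [i [_ _ _ dK ->]]] := kernel_ses hf sf.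
rewrite K0_dim0 ?add0r // dK; apply/eqP; rewrite subn_eq0.
rewrite -(mxsurj_rank f).1 //; have /mxinjP/row_fullP/eqP -> := jf.
exact: leqnn.
Qed.

(** Tensoring with a one-dimensional module changes a dimension m into 1 * m,
equal to m only up to a cast. *)
Lemma K0_cast M N (e : wdim M = wdim N) :
  (forall D, wact N D = castmx (e, e) (wact M D)) -> K0_class M = K0_class N.
Proof.
case: N e => n a alin abr /= e; case: n / e a alin abr => a alin abr aE.
apply: (@K0_iso M (Wmod alin abr) (1%:M : 'M_(wdim M))) => [D|u v|v];
  rewrite ?mul1mx ?mulmx1 //=.
by exists v; rewrite mul1mx.
Qed.

(** The subspace of M on which g 0, ..., g (i - 1) vanish is the i-th step of a
filtration, and g i embeds the i-th graded piece into V i. Joint injectivity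
makes the filtration end at 0. When the dimensions add up, all these embeddings
have to be onto, hence no g i has to be shown surjective. *)
Theorem K0_filtration n M (V : nat -> wmod k p)
    (g : forall i, 'M_(wdim (V i), wdim M)) :
    (forall i, (i < n)%N -> forall D (v : 'cV_(wdim M)),
       (forall j, (j < i)%N -> g j *m v = 0) ->
       g i *m (wact M D *m v) = wact (V i) D *m (g i *m v)) ->
    (forall v : 'cV_(wdim M), (forall i, (i < n)%N -> g i *m v = 0) -> v = 0) ->
  (wdim M <= \sum_(i < n) wdim (V i))%N /\
  ((\sum_(i < n) wdim (V i) <= wdim M)%N ->
    K0_class M = \sum_(i < n) K0_class (V i)).
Proof.
elim: n => [|n IHn] in M V g *.
  move=> _ M0; suff dM : wdim M = 0%N.
    by rewrite !big_ord0 dM; split=> // _; exact: K0_dim0.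
  apply/eqP/negPn/negP; rewrite -lt0n => M_gt0.
  have /matrixP/(_ (Ordinal M_gt0) 0)/eqP : const_mx 1 = 0 :> 'cV[k]_(wdim M).
    exact: M0.
  by rewrite !mxE oner_eq0.
move=> hg g0; have whom_g : whom (g 0%N).
  move=> D; apply/trmx_inj/row_matrixP => i.
  rewrite -!tr_col; congr (_^T); rewrite !colE -!mulmxA.
  by rewrite hg.
have [D v fv|K [i [hi ji exi dK]]] := @kernel_exists M _ (g 0%N).
  by rewrite hg // fv mulmx0.
have [||dimK K0K] := IHn K (fun j => V j.+1) (fun j => g j.+1 *m i).
- move=> j jn D v gv; rewrite -!mulmxA -hg //.
    by rewrite [i *m (_ *m _)]mulmxA hi !mulmxA.
  case=> [_|l lj]; last by rewrite mulmxA; exact: gv.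
  by apply/exi; exists v.
- move=> v gv; have /mxinjP [r ri] := ji.
  suff iv : i *m v = 0 by rewrite -[v]mul1mx -ri -mulmxA iv mulmx0.
  apply: g0 => -[_|l ln]; last by rewrite mulmxA; exact: gv.
  by apply/exi; exists v.
rewrite !big_ord_recl /=; split.
  rewrite -(subnKC (rank_leq_col (g 0%N))) -dK leq_add // rank_leq_row.
  by [].
move=> dimM; have rk : \rank (g 0%N) = wdim (V 0%N).
  apply/eqP; rewrite eqn_leq rank_leq_row /=.
  rewrite -(leq_add2r (wdim K)) {2}dK subnKC ?rank_leq_col //.
  by apply: leq_trans dimM; rewrite leq_add2l.
have sg : mxsurj (g 0%N) by apply/mxsurj_rank.
rewrite (@K0_class_ses _ _ K M (V 0%N)); last by exists i, (g 0%N); split.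
rewrite addrC K0K // -(leq_add2l (\rank (g 0%N))) dK subnKC ?rank_leq_col //.
by rewrite rk.
Qed.

(** A split form of exactness is preserved by any additive functor, in
particular by tensoring; over a field the linear splittings r and s always
exist. *)
Lemma split_exact M N P
    (f : 'M_(wdim N, wdim M)) (g : 'M_(wdim P, wdim N)) r s :
    whom f -> whom g -> r *m f = 1%:M -> g *m s = 1%:M -> g *m f = 0 ->
    f *m r + s *m g = 1%:M ->
  short_exact M N P.
Proof.
move=> hf hg rf gs gf frsg; exists f, g; split=> //.
- by apply/mxinjP; exists r.
- by apply/mxsurjP; exists s.
move=> v; split=> [gv|[u ->]]; last by rewrite mulmxA gf mul0mx.
by exists (r *m v); rewrite -[LHS]mul1mx -frsg mulmxDl -!mulmxA gv mulmx0 addr0.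
Qed.

Lemma exact_split M N P : short_exact M N P ->
  exists (f : 'M_(wdim N, wdim M)) (g : 'M_(wdim P, wdim N)) r s,
  [/\ whom f /\ whom g, r *m f = 1%:M, g *m s = 1%:M, g *m f = 0 &
      f *m r + s *m g = 1%:M].
Proof.
case=> f [g [hf hg /mxinjP[r rf] /mxsurjP[s gs] ex]].
have gf : g *m f = 0.
  apply/matrixP => i j; suff /colP/(_ i) : col j (g *m f) = 0 by rewrite !mxE.
  by rewrite col_mulmx; apply/ex; exists (delta_mx j 0); rewrite colE.
(* A section of g corrected so that it becomes complementary to r. *)
exists f, g, r, (s - f *m (r *m s)); split=> //.
  by rewrite mulmxBr !mulmxA gf !mul0mx subr0.
have : 1%:M - s *m g = f *m (r *m (1%:M - s *m g)).
  apply: (exact_factor (fun v => (ex v).1) rf).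
  by rewrite mulmxBr mulmxA gs mulmx1 mul1mx subrr.
rewrite !mulmxBr mulmx1 => /eqP; rewrite subr_eq => /eqP ->.
by rewrite mulmxBl !mulmxA addrAC -addrA.
Qed.

Lemma tensor_exactl X M N P : short_exact M N P ->
  short_exact (tensor M X) (tensor N X) (tensor P X).
Proof.
case/exact_split=> f [g [r [s [[hf hg] rf gs gf frsg]]]].
apply: (@split_exact (tensor M X) (tensor N X) (tensor P X)
  (f *t 1%:M) (g *t 1%:M) (r *t 1%:M) (s *t 1%:M)).
- move=> D; rewrite /= /tensor_act mulmxDr mulmxDl !tensmx_mul.
  by rewrite !mulmx1 !mul1mx hf.
- move=> D; rewrite /= /tensor_act mulmxDr mulmxDl !tensmx_mul.
  by rewrite !mulmx1 !mul1mx hg.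
- by rewrite tensmx_mul rf mulmx1 tensmx11.
- by rewrite tensmx_mul gs mulmx1 tensmx11.
- by rewrite tensmx_mul gf tens0mx.
- by rewrite !tensmx_mul mulmx1 -tensmxDl frsg tensmx11.
Qed.

Lemma tensor_exactr X M N P : short_exact M N P ->
  short_exact (tensor X M) (tensor X N) (tensor X P).
Proof.
case/exact_split=> f [g [r [s [[hf hg] rf gs gf frsg]]]].
apply: (@split_exact (tensor X M) (tensor X N) (tensor X P)
  (1%:M *t f) (1%:M *t g) (1%:M *t r) (1%:M *t s)).
- move=> D; rewrite /= /tensor_act mulmxDr mulmxDl !tensmx_mul.
  by rewrite !mulmx1 !mul1mx hf.
- move=> D; rewrite /= /tensor_act mulmxDr mulmxDl !tensmx_mul.
  by rewrite !mulmx1 !mul1mx hg.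
- by rewrite tensmx_mul rf mulmx1 tensmx11.
- by rewrite tensmx_mul gs mulmx1 tensmx11.
- by rewrite tensmx_mul gf tensmx0.
- by rewrite !tensmx_mul mulmx1 -tensmxDr frsg tensmx11.
Qed.

Definition trivial_wmod : wmod k p.
Proof.
by apply: (@Wmod k p 1 (fun=> 0)) => [c D E|D E];
  rewrite ?scaler0 ?addr0 ?mulmx0 ?subr0.
Defined.

Lemma K0_tensor_triviall M : K0_class (tensor trivial_wmod M) = K0_class M.
Proof.
apply/esym/(@K0_cast M (tensor trivial_wmod M) (esym (mul1n _))) => D.
by rewrite /= /tensor_act /= tens0mx add0r tens_scalar1mx.
Qed.

Lemma K0_tensor_trivialr M : K0_class (tensor M trivial_wmod) = K0_class M.
Proof.
apply/esym/(@K0_cast M (tensor M trivial_wmod) (esym (muln1 _))) => D.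
by rewrite /= /tensor_act /= tensmx0 addr0 tens_mx_scalar scale1r.
Qed.

End Modules.

(** * Densities as baby Verma modules *)

Section Verma.
Variables (k : closedFieldType) (p : nat).
Hypothesis hp : p \in [pchar k].
Local Notation A := (tpoly k p).
Local Notation x := (tX k p).
Local Notation W := (witt k p).
Local Notation d := (xpartial hp 0).
Local Notation e := (xpartial hp).
Local Notation density := (density hp).

Lemma dens_xpartial c n j :
  dens hp c (e n) (x ^+ j) = (j%:R + c * n%:R) *: x ^+ (j + n).-1.
Proof.
rewrite /dens witt_exp !xpartial_tX partial_exp.
rewrite mulrnAl scalerDl -scalerA !scaler_nat -!exprD; congr (_ + c *: _).
  by case: j => // j; rewrite addSn.
by case: n => // n; rewrite /= addnS addnC.
Qed.

Lemma whom_xpartial (M N : wmod k p) (f : 'M_(wdim N, wdim M)) :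
  (forall n, (n < p)%N -> f *m wact M (e n) = wact N (e n) *m f) -> whom f.
Proof.
move=> hf D; have actE P :
    wact P D = \sum_(i < p) (D x : {poly k})`_i *: wact P (e i).
  rewrite {1}(witt_sum hp D) linear_sum.
  by apply: eq_bigr => i _; rewrite linearZZ.
rewrite !actE mulmx_suml mulmx_sumr; apply: eq_bigr => i _.
by rewrite -scalemxAl -scalemxAr hf.
Qed.

(** The weight is p - 1 + (lambda + 1), which is lambda in characteristic p. *)
Lemma density_weight lambda :
  @bplus_weight k p hp lambda (density lambda.+1%:R) (cvec (x ^+ p.-1)).
Proof.
have p0 := p_gt0 hp; have p1 : (p.-1 < p)%N by rewrite prednK.
split=> [|n /andP[n1 np]].
  rewrite /= opmx_tX // dens_xpartial addn1 /= linearZ /= mulr1.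
  by rewrite -natrD addnS -addSn prednK // natrD (pcharf0 hp) add0r.
rewrite /= opmx_tX // dens_xpartial tX_exp_ge ?scaler0 ?linear0 //.
case: n n1 {np} => [|[|n]] // _.
by rewrite addnS /= addnS -addSn prednK // leq_addr.
Qed.

Section Hom.
Variables (lambda : nat) (M : wmod k p) (z : 'cV[k]_(wdim M)).
Hypotheses (rM : restricted hp M) (hz : bplus_weight hp lambda z).

(** The factor is the inverse of (p-1)(p-2)...(j+1), the coefficient with which
d^(p-1-j) sends x^(p-1) to x^j. These vectors are thus the only possible images
of the x^j under a morphism mapping x^(p-1) to z. *)
Definition verma_vec (j : nat) : 'cV[k]_(wdim M) :=
  if (j < p)%N
  then (j`!%:R / (p.-1)`!%:R) *: (wact M d ^+ (p.-1 - j) *m z) else 0.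

Lemma verma_vec_top : verma_vec p.-1 = z.
Proof.
have p1 : (p.-1 < p)%N by rewrite prednK ?(p_gt0 hp).
by rewrite /verma_vec p1 subnn expr0 mul1mx divff ?scale1r ?(fact_neq0 hp).
Qed.

Lemma verma_vec_partial j :
  wact M d *m verma_vec j.+1 = j.+1%:R *: verma_vec j.
Proof.
rewrite /verma_vec; case: ltnP => [jp|]; last first.
  rewrite leq_eqVlt => /predU1P[<-|jp].
    by rewrite (pcharf0 hp) scale0r mulmx0.
  by rewrite ltnNge -ltnS jp /= scaler0 mulmx0.
rewrite (ltnW jp) -scalemxAr scalerA mulrA -natrM -factS.
rewrite mulmxA -[wact M d *m _]exprS.
congr (_ *: (_ ^+ _ *m _)).
by rewrite -subSn ?subSS // -ltnS prednK ?(p_gt0 hp).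
Qed.

(** This is where restrictedness enters: d^p acts as the p-th power of d in the
restricted structure, which is zero. *)
Lemma verma_vec_partial0 : wact M d *m verma_vec 0 = 0.
Proof.
rewrite /verma_vec (p_gt0 hp) -scalemxAr subn0 mulmxA -[wact M d *m _]exprS.
by rewrite prednK ?(p_gt0 hp) // -rM wpow_partial linear0 mul0mx scaler0.
Qed.

(** The case n = 0 is the definition of the vectors. For e (n + 1) one descends
from j = p - 1, where the weight conditions on z apply: j + 1 times the j-th
vector is the image under d of the next one, and [e (n + 1), d] is a multiple of
e n. *)
Lemma verma_vec_act n j :
  wact M (e n) *m verma_vec j =
  (j%:R + lambda.+1%:R * n%:R) *: verma_vec (j + n).-1.
Proof.
have p0 := p_gt0 hp.
elim: n => [|n IHn] in j *.
  case: j => [|j]; first by rewrite verma_vec_partial0 mulr0 addr0 scale0r.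
  by rewrite verma_vec_partial mulr0 addr0 addn0.
have vec_ge i : (p <= i)%N -> verma_vec i = 0.
  by rewrite /verma_vec leqNgt => /negPf->.
have [m] := ubnP (p - j); elim: m => // m IHm in j * => jm.
have [pj|jp] := leqP p j.
  by rewrite !vec_ge ?mulmx0 ?scaler0 // addnS (leq_trans pj) ?leq_addr.
have [jp1|jp1] := eqVneq j p.-1.
  rewrite jp1 verma_vec_top; case: n {IHn IHm} => [|n].
    rewrite hz.1 addn1 /= verma_vec_top mulr1 -natrD addnS -addSn prednK //.
    by rewrite natrD (pcharf0 hp) add0r.
  rewrite vec_ge ?scaler0; last first.
    by rewrite addnS /= addnS -addSn prednK // leq_addr.
  have [np|np] := ltnP n.+2 p; first exact: hz.2.
  rewrite (_ : e n.+2 = 0) ?linear0 ?mul0mx //.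
  by apply: (witt_eq hp); rewrite xpartial_tX tX_exp_ge // zero_lfunE.
have jp2 : (j.+1 < p)%N.
  by rewrite -ltn_predRL ltn_neqAle jp1 -ltnS prednK.
have j1 : j.+1%:R != 0 :> k by rewrite (natr_neq0 hp).
have eEd : wact M (e n.+1) *m wact M d =
    wact M d *m wact M (e n.+1) - n.+1%:R *: wact M (e n).
  have := @wact_bracket _ _ M (e n.+1) d.
  rewrite bracket_partial linearN linearZZ => ->.
  by rewrite addrCA subrr addr0.
apply: (scalerI j1); rewrite scalemxAr -verma_vec_partial mulmxA eEd mulmxBl.
rewrite -mulmxA IHm // ?ltn_sub2l //; last first.
  by rewrite -ltnS (leq_trans _ jm) // ltnS ltn_sub2l.
rewrite addSn /= -scalemxAr addnS verma_vec_partial -scalemxAl IHn addSn /=.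
rewrite !scalerA -scalerBl; congr (_ *: _).
rewrite -!natr1 !natrD; ring.
Qed.

Lemma density_hom : exists g : 'M_(wdim M, wdim (density lambda.+1%:R)),
  whom g /\ g *m cvec (x ^+ p.-1) = z.
Proof.
pose g : 'M_(wdim M, p) := \matrix_(i, j) verma_vec j i 0.
have gE j : g *m cvec (x ^+ j) = verma_vec j.
  case: (ltnP j p) => jp; last first.
    by rewrite (tX_exp_ge hp jp) linear0 mulmx0 /verma_vec ltnNge jp.
  rewrite -(cvec_delta hp (Ordinal jp)) -colE.
  by apply/colP => i; rewrite !mxE.
exists g; split; last by rewrite gE verma_vec_top.
apply: whom_xpartial => n np; apply: (cvec_ext hp) => j jp.
rewrite -!mulmxA gE opmx_tX // dens_xpartial linearZ /= -scalemxAr gE.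
by rewrite verma_vec_act.
Qed.

End Hom.

(** Let g : density -> Z and f : Z -> density be the two morphisms matching the
generators. Then g f fixes the generator of Z, hence is the identity by the
uniqueness part of the universal property, and g is onto. *)
Theorem density_onto_simple lambda (Z L : wmod k p) :
    baby_verma hp lambda Z -> simple_quotient Z L ->
  exists f : 'M_(wdim L, wdim (density lambda.+1%:R)), whom f /\ mxsurj f.
Proof.
move=> [rZ [z wz uZ]] [simL [q [hq sq]]].
have [g [hg gz]] := density_hom rZ wz.
have [f [[hf fz] _]] :=
  uZ _ _ (density_restricted hp _) (density_weight lambda).
have [h [_ hU]] := uZ _ _ rZ wz.
have gf1 : g *m f = 1%:M.
  rewrite -(hU 1%:M) ?(hU (g *m f)) //; split; rewrite ?mul1mx //.
  - exact: whom_mul hf hg.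
  - by rewrite -mulmxA fz.
  - exact: whom1.
exists (q *m g); split; first exact: whom_mul hg hq.
have /mxsurjP [s qs] := sq.
apply/mxsurjP; exists (f *m s).
by rewrite mulmxA -[q *m g *m f]mulmxA gf1 mulmx1.
Qed.

End Verma.

(** * Composition factors of densities *)

Section Kernels.
Variables (k : closedFieldType) (p : nat).
Hypothesis hp : p \in [pchar k].
Local Notation A := (tpoly k p).
Local Notation x := (tX k p).
Local Notation W := (witt k p).
Local Notation d := (xpartial hp 0).
Local Notation e := (xpartial hp).
Local Notation density := (density hp).

(** Degrees are less than p, so differentiating never kills the leading term. *)
Lemma size_partial (a : A) :
  size (d a : {poly k}) = (size (a : {poly k})).-1.
Proof.
have size1 : (size (d a : {poly k}) <= (size (a : {poly k})).-1)%N.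
  by rewrite partial_val size_poly.
apply/eqP; rewrite eqn_leq size1 /=.
case sa : (size (a : {poly k})) => [|[|n]] //=.
rewrite ltnNge; apply/negP => /leq_sizeP/(_ n (leqnn n))/eqP.
rewrite partial_val // coef_deriv -mulr_natr mulf_eq0 => /orP[|].
  have := lead_coef_eq0 (a : {poly k}); rewrite /lead_coef sa /= => ->.
  by rewrite -size_poly_eq0 sa.
by apply/negP/(natr_neq0 hp); rewrite /= -sa size_tpoly.
Qed.

Lemma size1_tpoly (a : A) : size (a : {poly k}) = 1%N ->
  exists2 c : k, c != 0 & a = c *: 1.
Proof.
move/eqP/size_poly1P => [c c0 ac]; exists c => //; apply/val_inj => /=.
by rewrite ac alg_polyC.
Qed.

Lemma partial_eq0 (a : A) : d a = 0 -> exists c : k, a = c *: 1.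
Proof.
move=> da; case sa: (size (a : {poly k})) => [|[|n]].
- move/eqP: sa; rewrite size_poly_eq0 => /eqP a0.
  by exists 0; rewrite scale0r; apply/val_inj.
- by have [c _ ->] := size1_tpoly sa; exists c.
have := size_partial a.
by rewrite da sa /= size_poly0.
Qed.

Lemma partial_onto (a : A) : (a : {poly k})`_p.-1 = 0 -> exists b, d b = a.
Proof.
move=> a_top; have p0 := p_gt0 hp.
exists (\sum_(j < p) ((a : {poly k})`_j / j.+1%:R) *: x ^+ j.+1).
transitivity (\sum_(j < p) d (((a : {poly k})`_j / j.+1%:R) *: x ^+ j.+1)).
  exact: linear_sum.
rewrite [RHS](tpoly_sum a) //; apply: eq_bigr => j _.
rewrite wittZ partial_exp /= -scaler_nat scalerA.
have [->|jp] := eqVneq (j : nat) p.-1; first by rewrite a_top !mul0r.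
rewrite divfK // (natr_neq0 hp) //=.
by rewrite -ltn_predRL ltn_neqAle jp -ltnS prednK /=.
Qed.

Section Hom.
Variables (c : k) (M : wmod k p) (f : 'M[k]_(wdim M, p)).
Hypothesis hf : @whom k p (density c) M f.

Lemma hom_dens D a : f *m cvec (dens hp c D a) = wact M D *m (f *m cvec a).
Proof.
by rewrite -(opmx_cvec hp) mulmxA -[opmx _]/(wact (density c) D) hf mulmxA.
Qed.

Lemma ker_dens D a : f *m cvec a = 0 -> f *m cvec (dens hp c D a) = 0.
Proof. by rewrite hom_dens => ->; rewrite mulmx0. Qed.

Lemma ker_scale b a : b != 0 -> f *m cvec (b *: a) = 0 -> f *m cvec a = 0.
Proof.
move=> b0; rewrite linearZ /= -scalemxAr => /eqP.
by rewrite scaler_eq0 (negPf b0) => /eqP.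
Qed.

Lemma ker_partial a : f *m cvec a = 0 -> f *m cvec (d a) = 0.
Proof.
move=> /(ker_dens d).
by rewrite /dens partial_tX witt1 mul0r scaler0 addr0.
Qed.

(** Apply d until the degree has dropped to the desired one. *)
Lemma ker_size m a : f *m cvec a = 0 -> (m <= size (a : {poly k}))%N ->
  exists2 b : A, f *m cvec b = 0 & size (b : {poly k}) = m.
Proof.
move=> fa ma; have [n] := ubnP (size (a : {poly k}) - m)%N.
elim: n a fa ma => // n IHn a fa ma sam.
have [sa|ne] := eqVneq (size (a : {poly k})) m; first by exists a.
have lt : (m < size (a : {poly k}))%N by rewrite ltn_neqAle eq_sym ne.
apply: (IHn (d a)); rewrite ?size_partial; first exact: ker_partial.
  by rewrite -ltnS prednK // (leq_ltn_trans _ lt).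
by rewrite -ltnS (leq_trans _ sam) // ltnS -subn1 subnAC subn1 prednK ?subn_gt0.
Qed.

(** The kernel of a morphism is a submodule, and a nonzero submodule contains a
nonzero constant, obtained by lowering the degree to 0. *)
Lemma ker_one a : a != 0 -> f *m cvec a = 0 -> f *m cvec 1 = 0.
Proof.
move=> a0 fa; have [|b fb /size1_tpoly[s s0 bE]] := ker_size (m := 1) fa.
  by rewrite lt0n size_poly_eq0.
by move: fb; rewrite bE; exact: ker_scale.
Qed.

(** In weight c, e_n sends 1 to c (n + 1) x^n. *)
Lemma ker_one_lt n : c != 0 -> f *m cvec 1 = 0 -> (n.+1 < p)%N ->
  f *m cvec (x ^+ n) = 0.
Proof.
move=> c0 f1 np; have := ker_dens (e n.+1) f1.
rewrite -(expr0 x) dens_xpartial add0n add0r; apply: ker_scale.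
by rewrite mulf_neq0 // (natr_neq0 hp).
Qed.

(** The monomial x^(p-1) cannot be reached from 1 directly as e_(p-1) = 0, but
e_1 sends x^(p-2) to (p - 2 + 2 c) x^(p-1) = 2 (c - 1) x^(p-1). *)
Lemma ker_one_top : (2 < p)%N -> c != 0 -> c != 1 ->
  f *m cvec 1 = 0 -> f *m cvec (x ^+ p.-1) = 0.
Proof.
move=> p2 c0 c1 f1; have p21 : (p.-2.+2 = p)%N by case: (p) p2 => [|[|]].
have np2 : p.-2%:R = - 2%:R :> k.
  by apply/eqP; rewrite -subr_eq0 opprK -natrD addn2 p21 (pcharf0 hp).
have p1 : (p.-2.+1 < p)%N by rewrite -{2}p21.
have := ker_dens (e 2) (ker_one_lt c0 f1 p1).
have p22 : p.-2.+1 = p.-1 by rewrite -[in RHS]p21.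
rewrite dens_xpartial addn2 /= p22; apply: ker_scale.
rewrite np2 -[- _]mulN1r -mulrDl mulf_neq0 ?(natr_neq0 hp) //.
by rewrite addrC subr_eq0.
Qed.

(** An element of degree 1 in the kernel is enough: on functions, e_(j-1) sends
it to a nonzero multiple of x^j for every j. *)
Lemma ker_size2 a : c = 0 -> f *m cvec a = 0 -> (1 < size (a : {poly k}))%N ->
  f = 0.
Proof.
move=> c0 fa sa; have [b fb sb] := ker_size fa sa.
have [s s0 dbE] : exists2 s : k, s != 0 & d b = s *: 1.
  by apply: size1_tpoly; rewrite size_partial sb.
apply: (cvec_ext hp) => j jp; rewrite mul0mx; apply: (ker_scale s0).
have := ker_dens (e j) fb.
by rewrite c0 dens0 (wittE hp) dbE xpartial_tX -scalerAr mulr1.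
Qed.

Lemma hom_inj : f *m cvec 1 != 0 -> mxinj f.
Proof.
move=> f1; apply: mxinj_ker0 => v fv; rewrite -(tpoly_of_cvecK hp v).
have [->|v0] := eqVneq (tpoly_of_cvec v) 0; first by rewrite linear0.
by case/eqP: f1; apply: (ker_one v0); rewrite tpoly_of_cvecK.
Qed.

Lemma hom_neq0 : mxsurj f -> (0 < wdim M)%N -> f != 0.
Proof.
move=> /mxsurj_rank rf M0; apply/eqP => f0.
by move: M0; rewrite -rf f0 mxrank0.
Qed.

End Hom.

Lemma K0_density_simple c (L : wmod k p) (f : 'M_(wdim L, wdim (density c))) :
    (2 < p)%N -> c != 0 -> c != 1 -> simple_wmod L -> whom f -> mxsurj f ->
  K0_class (density c) = K0_class L.
Proof.
move=> p2 c0 c1 [L0 _] hf sf; apply: (K0_iso hf) => //; apply: (hom_inj hf).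
apply/negP => /eqP f1; case/eqP: (hom_neq0 sf L0).
apply: (cvec_ext hp) => j jp; rewrite mul0mx.
have [->|jp1] := eqVneq j p.-1; first exact: (ker_one_top hf).
apply: (ker_one_lt hf) => //.
by rewrite -ltn_predRL ltn_neqAle jp1 -ltnS prednK ?(p_gt0 hp).
Qed.

Lemma cvec1_neq0 : cvec (1 : A) != 0.
Proof.
by apply/eqP => /(cvec_eq0 hp)/eqP; rewrite oner_eq0.
Qed.

Lemma colinj n (v : 'cV[k]_n) : v != 0 -> mxinj v.
Proof.
move=> v0; apply: mxinj_ker0 => u; rewrite [u]mx11_scalar mul_mx_scalar.
by move/eqP; rewrite scaler_eq0 (negPf v0) orbF => /eqP ->; rewrite raddf0.
Qed.

(** The constants map to a submodule of the simple module L. If f did not kill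
1, this would be all of L, so L would be a line, while f would be injective by
[ker_one]. Nothing else is killed, by [ker_size2], since f is not zero. *)
Lemma density0_exact (L : wmod k p) (f : 'M[k]_(wdim L, p)) :
    simple_wmod L -> @whom k p (density 0) L f -> mxsurj f ->
  [/\ f *m cvec 1 = 0,
      forall v : 'cV_p, f *m v = 0 -> exists u : 'cV_1, v = cvec 1 *m u &
      short_exact (trivial_wmod k p) (density 0) L].
Proof.
move=> simL hf sf.
have h1 : @whom k p (trivial_wmod k p) (density 0) (cvec 1).
  by move=> D; rewrite /= mulmx0 opmx_cvec //= dens0 witt1 linear0.
have f1 : f *m cvec 1 = 0.
  apply/eqP/negPn/negP => f1.
  have [/eqP|/mxsurj_rank rk] := simple_hom simL (whom_mul h1 hf).
    by rewrite (negPf f1).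
  have /mxinjP/row_fullP/eqP rf := hom_inj hf f1.
  have := p_gt1 hp; rewrite -rf ltnNge; case/negP.
  by rewrite (leq_trans (rank_leq_row f)) // -rk rank_leq_col.
have exf v : f *m v = 0 -> exists u : 'cV_1, v = cvec 1 *m u.
  move=> fv; rewrite -(tpoly_of_cvecK hp v); set a := tpoly_of_cvec v.
  have [c ->] : exists c : k, a = c *: 1.
    apply: partial_eq0; apply/eqP; rewrite -[_ == _]size_poly_eq0 size_partial.
    rewrite -subn1 subn_eq0 leqNgt; apply/negP => sa.
    case/eqP: (hom_neq0 sf simL.1); apply: (ker_size2 hf _ _ sa) => //.
    by rewrite tpoly_of_cvecK.
  by exists c%:M; rewrite mul_mx_scalar linearZ.
split=> //; exists (cvec 1), f; split=> //; first exact: colinj cvec1_neq0.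
by move=> v; split=> [/exf//|[u ->]]; rewrite mulmxA f1 mul0mx.
Qed.

(** The exact forms map to a submodule of L0. If f0 did not kill the exact form
dx, this would be all of L0, of dimension less than p as d has a kernel, while
f0 would be injective by [ker_one]. So f0 kills dx, hence all the exact forms,
which have codimension 1, and L0 is spanned by the image of x^(p-1) dx, on which
the action is trivial because the Lie derivative of a 1-form is exact. The
exterior derivative vanishes on the constants, the kernel of f1, and so it
factors through L1. *)
Lemma density1_exact (L0 L1 : wmod k p) (f1 : 'M[k]_(wdim L1, p))
    (f0 : 'M[k]_(wdim L0, p)) :
    simple_wmod L1 -> @whom k p (density 0) L1 f1 -> mxsurj f1 ->
    simple_wmod L0 -> @whom k p (density 1) L0 f0 -> mxsurj f0 ->
  K0_class (trivial_wmod k p) = K0_class L0 /\ short_exact L1 (density 1) L0.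
Proof.
move=> simL1 hf1 sf1 simL0 hf0 sf0; have p0 := p_gt0 hp.
have [f11 exf1 _] := density0_exact simL1 hf1 sf1.
pose dl : 'M_p := opmx d.
have dlE a : dl *m cvec a = cvec (d a) by rewrite opmx_cvec.
have hdl : @whom k p (density 0) (density 1) dl.
  move=> D; rewrite /= !opmx_comp //; apply: eq_opmx => a /=.
  by rewrite -dens_partial dens0.
have f01 : f0 *m cvec 1 = 0.
  apply/eqP/negPn/negP => f01.
  have [/(congr1 (mulmx^~ (cvec x)))/eqP|/mxsurj_rank rk] :=
      simple_hom simL0 (whom_mul hdl hf0).
    by rewrite -mulmxA dlE partial_tX mul0mx (negPf f01).
  have /mxinjP/row_fullP/eqP rf := hom_inj hf0 f01.
  have /row_fullP/mxinjP : row_full (f0 *m dl).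
    by rewrite /row_full eqn_leq rank_leq_col rk -{1}rf rank_leq_row.
  move/(_ (cvec 1) 0); rewrite mulmx0 -mulmxA dlE witt1 linear0 mulmx0.
  by move/(_ erefl)/eqP; rewrite (negPf cvec1_neq0).
have f0lt n : (n.+1 < p)%N -> f0 *m cvec (x ^+ n) = 0.
  by apply: (ker_one_lt hf0) => //; exact: oner_neq0.
have f0dl : f0 *m dl = 0.
  apply: (cvec_ext hp) => -[|j] jp; rewrite -mulmxA dlE partial_exp mul0mx.
    by rewrite linear0 mulmx0.
  by rewrite linearMn /= -scaler_nat -scalemxAr f0lt ?scaler0.
(* The image of x^(p-1) dx, which spans L0. *)
pose t := f0 *m cvec (x ^+ p.-1).
have t0 : t != 0.
  apply/negP => /eqP t0; case/eqP: (hom_neq0 sf0 simL0.1).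
  apply: (cvec_ext hp) => j jp; rewrite mul0mx.
  have [->//|jp1] := eqVneq j p.-1; apply: f0lt.
  by rewrite -ltn_predRL ltn_neqAle jp1 -ltnS prednK.
have ht : @whom k p (trivial_wmod k p) L0 t.
  move=> D; rewrite /= mulmx0 -(hom_dens hf0).
  rewrite (_ : dens hp 1 D _ = d (D x * x ^+ p.-1)).
    by rewrite -dlE mulmxA f0dl mul0mx.
  by rewrite /dens scale1r wittP addrC (wittE hp D (x ^+ _)).
split.
  have [t0'|st] := simple_hom simL0 ht; first by rewrite t0' eqxx in t0.
  exact: (K0_iso ht (colinj t0) st).
have [s fs] := (mxsurjP f1).1 sf1.
(* s is a linear section of f1, so dl *m s is the map that dl induces on L1. *)
have dl_fact : dl = dl *m s *m f1.
  have [r r1] := (mxinjP (cvec (1 : A))).1 (colinj cvec1_neq0).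
  apply/eqP; rewrite -subr_eq0 -[X in X - _]mulmx1 -mulmxA -mulmxBr; apply/eqP.
  rewrite (exact_factor exf1 r1 (B := 1%:M - s *m f1)).
    by rewrite [dl *m _]mulmxA dlE witt1 linear0 mul0mx.
  by rewrite mulmxBr mulmxA fs mulmx1 mul1mx subrr.
exists (dl *m s), f0; split=> //.
- move=> D; rewrite -[LHS]mulmx1 -fs !mulmxA.
  rewrite -[dl *m s *m _ *m f1]mulmxA -hf1 mulmxA -dl_fact hdl.
  by rewrite -!mulmxA.
- apply: mxinj_ker0 => u; rewrite -mulmxA => dlsu.
  rewrite -[u]mul1mx -fs -mulmxA; move: (s *m u) dlsu => v.
  rewrite -(tpoly_of_cvecK hp v) dlE => /(cvec_eq0 hp)/partial_eq0[c ->].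
  by rewrite linearZ /= -scalemxAr f11 scaler0.
move=> v; split=> [f0v|[u ->]]; last by rewrite !mulmxA f0dl !mul0mx.
set a := tpoly_of_cvec v; have va : v = cvec a by rewrite tpoly_of_cvecK.
have a_top : (a : {poly k})`_p.-1 = 0.
  have p1 : (p.-1 < p)%N by rewrite prednK.
  move: f0v; rewrite va [a in cvec a](tpoly_sum a) // linear_sum mulmx_sumr.
  rewrite (bigD1 (Ordinal p1)) //= big1 => [|i ip]; last first.
    rewrite linearZ /= -scalemxAr f0lt ?scaler0 //.
    by rewrite -ltn_predRL ltn_neqAle -ltnS prednK // ltn_ord andbT.
  rewrite addr0 linearZ /= -scalemxAr => /eqP.
  by rewrite scaler_eq0 (negPf t0) orbF => /eqP.
have [b db] := partial_onto a_top.
by exists (f1 *m cvec b); rewrite mulmxA -dl_fact dlE db.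
Qed.

End Kernels.

(** * The filtration of the tensor square by powers of the diagonal ideal *)

Section Jets.
Variables (k : closedFieldType) (p : nat).
Hypothesis hp : p \in [pchar k].
Local Notation A := (tpoly k p).
Local Notation x := (tX k p).
Local Notation W := (witt k p).
Local Notation d := (xpartial hp 0).
Local Notation density := (density hp).

(** The equality, rather than an isomorphism, makes it possible to replace the
module under the tensor product. *)
Lemma natural_density : natural k p = density 0.
Proof.
have wmodP n (a b : W -> 'M[k]_n) al ab bl bb : a = b ->
    @Wmod k p n a al ab = @Wmod k p n b bl bb.
  by move=> e; case: b / e bl bb => bl bb; congr Wmod; exact: Prop_irrelevance.
by apply: wmodP; apply/funext => D; apply: eq_opmx => a; rewrite dens0.
Qed.

Lemma iter_partial_tX n j : iter n d (x ^+ j) = x ^+ (j - n) *+ (j ^_ n).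
Proof.
elim: n => [|n IHn]; first by rewrite subn0 ffactn0.
rewrite iterS IHn ffactnSr mulnC mulrnA subnS -partial_exp.
by elim: (j ^_ n) => [|m IH]; rewrite ?mulr0n ?linear0 // !mulrSr -IH wittD.
Qed.

(** On A(1) (x) A(1), with t = 1 (x) x - x (x) 1, the function a (x) b expands
in powers of t as a b(x + t); this matrix extracts n! times the coefficient a
d^n b / n! of t^n. *)
Definition jetmx n : 'M[k]_(p, p * p) :=
  \matrix_(l, s) (x ^+ (mxtens_unindex s).1 *
                  iter n d (x ^+ (mxtens_unindex s).2) : {poly k})`_l.

Lemma jetmxE n v : jetmx n *m v = cvec (\sum_s v s 0 *:
  (x ^+ (mxtens_unindex s).1 * iter n d (x ^+ (mxtens_unindex s).2))).
Proof.
apply/colP => l; rewrite linear_sum summxE mxE; apply: eq_bigr => s _.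
by rewrite linearZ !mxE mulrC.
Qed.

Lemma iter_witt_linear (D : W) n : linear (iter n D).
Proof. by move=> c a b; elim: n => //= n ->; rewrite wittD wittZ. Qed.

HB.instance Definition _ (D : W) n :=
  GRing.isLinear.Build k A A _ (iter n D) (iter_witt_linear D n).

Lemma jetmx_tens n (a b : A) :
  jetmx n *m (cvec a *t cvec b) = cvec (a * iter n d b).
Proof.
have p0 := p_gt0 hp.
have iterE : iter n d b = \sum_(j < p) (b : {poly k})`_j *: iter n d (x ^+ j).
  rewrite {1}(tpoly_sum b) //.
  rewrite -[iter n d _]/((iter n d : {linear A -> A}) _) linear_sum.
  by apply: eq_bigr => j _; rewrite linearZZ.
rewrite jetmxE iterE [X in _ = cvec (X * _)](tpoly_sum a) // mulr_sum.
congr cvec; apply: eq_bigr => s _.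
by rewrite !mxE -scalerAl -scalerAr scalerA.
Qed.

Lemma tens_ext m (B C : 'M[k]_(m, p * p)) :
  (forall a b : A, B *m (cvec a *t cvec b) = C *m (cvec a *t cvec b)) -> B = C.
Proof.
move=> BC; apply/matrixP => i s; case: (mxtens_indexP s) => s1 s2.
have key (E : 'M[k]_(m, p * p)) :
    (E *m (cvec (x ^+ s1) *t cvec (x ^+ s2))) i 0 = E i (mxtens_index (s1, s2)).
  rewrite mxE (bigD1 (mxtens_index (s1, s2))) //= big1 ?addr0 => [|t].
    by rewrite mxE mxtens_indexK !ord1 !cvec_tX // !eqxx !mulr1.
  case: (mxtens_indexP t) => t1 t2.
  rewrite (inj_eq (can_inj (@mxtens_indexK _ _))) => ne.
  rewrite mxE mxtens_indexK !ord1 !cvec_tX // -natrM mulnb.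
  by rewrite -[_ && _]/((t1, t2) == (s1, s2)) (negPf ne) mulr0.
by rewrite -!key BC.
Qed.

(** With D = f d/dx, expand d^n (f d b) by Leibniz' rule: f and f' contribute
the Lie derivative of d^n b as a density of weight n, and the higher derivatives
of f come with derivatives of b of order less than n. *)
Lemma iter_partial_witt n (D : W) b :
  iter n d (D b) = dens hp n%:R D (iter n d b) +
    \sum_(i < n.-1) (iter (n - i) d (D x) *+ 'C(n, i)) * iter i.+1 d b.
Proof.
rewrite (wittE hp D b) iter_leibniz /dens scaler_nat.
case: n => [|n]; first by rewrite big_ord1 big_ord0 !addr0 /= -wittE.
rewrite !big_ord_recr /= subnn subSnn binn binSn mulr1n -!iterSr addrC.
rewrite [X in _ + X]addrC addrA (wittE hp D (iter n.+1 d b)).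
congr (_ + _ + _).
by apply: eq_bigr => i _; rewrite -iterSr mulrnAl.
Qed.

(** The error terms involve the matrices of index 1, ..., n - 1 only, so they
vanish on the n-th step of the filtration, where jetmx n is therefore
equivariant. *)
Lemma jetmx_act n (D : W) :
  jetmx n *m tensor_act (natural k p) (natural k p) D =
  wact (density n%:R) D *m jetmx n +
  \sum_(i < n.-1)
    opmx ((iter (n - i) d (D x) *+ 'C(n, i)) \*o idfun) *m jetmx i.+1.
Proof.
apply: tens_ext => a b.
have nat_act c : natural_act D *m cvec c = cvec (D c).
  by rewrite -(opmx_cvec hp (wval D)).
have tens_act : tensor_act (natural k p) (natural k p) D *m (cvec a *t cvec b) =
    cvec (D a) *t cvec b + cvec a *t cvec (D b).
  by rewrite mulmxDl !tensmx_mul !mul1mx !nat_act.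
rewrite -[LHS]mulmxA tens_act.
rewrite mulmxDr !jetmx_tens mulmxDl mulmx_suml -mulmxA jetmx_tens /=.
rewrite opmx_cvec //.
rewrite -linearD iter_partial_witt /=.
rewrite [in RHS](eq_bigr (fun i : 'I_n.-1 => cvec
  ((iter (n - i) d (D x) *+ 'C(n, i)) * (a * iter i.+1 d b)))); last first.
  by move=> i _; rewrite -[LHS]mulmxA jetmx_tens opmx_cvec.
transitivity (cvec (dens hp n%:R D (a * iter n d b) + \sum_(i < n.-1)
    (iter (n - i) d (D x) *+ 'C(n, i)) * (a * iter i.+1 d b))); last first.
  by rewrite linearD linear_sum.
congr cvec.
rewrite mulrDr addrA [X in X + _](_ : _ = dens hp n%:R D (a * iter n d b)).
  by rewrite mulr_sumr; congr (_ + _); apply: eq_bigr => i _; rewrite mulrCA.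
by rewrite -{2}[n%:R]add0r densM dens0.
Qed.

(** Write v as the sum of the a_j (x) x^j. As d^n x^j = 0 for j < n, the system
sum_j a_j d^n x^j = 0 is triangular, with invertible diagonal entries n!; it is
solved downwards from j = p - 1. *)
Lemma jetmx_inj v :
  (forall n, (n < p)%N -> jetmx n *m v = 0) -> v = 0 :> 'cV_(p * p).
Proof.
move=> jv.
pose a (j : 'I_p) : A :=
  \sum_(s | (mxtens_unindex s).2 == j) v s 0 *: x ^+ (mxtens_unindex s).1.
have jetE n : jetmx n *m v = cvec (\sum_j a j * iter n d (x ^+ j)).
  rewrite jetmxE (partition_big (fun s => (mxtens_unindex s).2) xpredT) //=.
  congr cvec; apply: eq_bigr => j _; rewrite mulr_suml.
  by apply: eq_bigr => s /eqP <-; rewrite scalerAl.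
have a0 j : a j = 0.
  have [m] := ubnP (p - j); elim: m j => // m IHm j pj.
  have := jv j (ltn_ord j); rewrite jetE => /(cvec_eq0 hp).
  rewrite (bigD1 j) //= big1 => [|i ij].
    rewrite addr0 iter_partial_tX subnn ffactnn expr0 -scaler_nat -scalerAr.
    rewrite mulr1.
    by move/eqP; rewrite scaler_eq0 (negPf (fact_neq0 hp _)) // => /eqP.
  rewrite iter_partial_tX; have [lt|gt|e] := ltngtP i j.
  - by rewrite ffact_small // mulr0n mulr0.
  - by rewrite IHm ?mul0r // -ltnS (leq_trans _ pj) // ltnS ltn_sub2l.
  - by rewrite (val_inj e) eqxx in ij.
apply/colP => s; case: (mxtens_indexP s) => i j; rewrite [RHS]mxE.
have entry t : cvec (v t 0 *: x ^+ (mxtens_unindex t).1) i 0 =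
    v t 0 * (i == (mxtens_unindex t).1)%:R.
  by rewrite linearZZ mxE cvec_tX.
have sumE : cvec (a j) i 0 = \sum_(s | (mxtens_unindex s).2 == j)
    cvec (v s 0 *: x ^+ (mxtens_unindex s).1) i 0.
  by rewrite linear_sum summxE.
have c0 : cvec (0 : A) i 0 = 0 by rewrite linear0 mxE.
move: sumE; rewrite a0 c0 (bigD1 (mxtens_index (i, j))); last first.
  by rewrite mxtens_indexK.
rewrite entry mxtens_indexK eqxx mulr1 big1 => [/esym|t].
  by rewrite /= addr0.
case: (mxtens_indexP t) => t1 t2 /andP[].
rewrite entry mxtens_indexK /= => /eqP ->.
rewrite (inj_eq (can_inj (@mxtens_indexK _ _))) xpair_eqE eqxx andbT eq_sym.
by move/negPf->; rewrite mulr0.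
Qed.

(** The dimensions add up: p modules of dimension p on both sides. *)
Theorem K0_natural_square :
  K0_class (tensor (natural k p) (natural k p)) =
  \sum_(n < p) K0_class (density n%:R).
Proof.
have [|v jv|_] := @K0_filtration k p p (tensor (natural k p) (natural k p))
    (fun n => density n%:R) jetmx.
- move=> n np D v jv; rewrite mulmxA [wact (tensor _ _) D]/= jetmx_act mulmxDl.
  rewrite mulmxA mulmx_suml big1 ?addr0 // => i _.
  by rewrite -mulmxA jv ?mulmx0 // -ltn_predRL.
- exact: jetmx_inj.
by apply; rewrite /= sum_nat_const card_ord.
Qed.

End Jets.

Theorem corollary4p8 (k : closedFieldType) (p : nat) (hp : p \in [pchar k])
    (hp3 : (3 < p)%N) (Z L : nat -> wmod k p)
    (hZ : forall lambda, (lambda < p)%N -> baby_verma hp lambda (Z lambda))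
    (hL : forall lambda, (lambda < p)%N ->
       simple_quotient (Z lambda) (L lambda)) :
  K0_class (tensor (natural k p) (natural k p)) =
    K0_class (L 0%N) *+ 2 + K0_class (L p.-1) *+ 2
      + \sum_(1 <= i < p.-1) K0_class (L i)
  /\
  K0_class (tensor (L p.-1) (L p.-1)) = \sum_(0 <= j < p.-1) K0_class (L j).
Proof.
have p0 := p_gt0 hp; have p1 := p_gt1 hp.
have p1p : (p.-1 < p)%N by rewrite prednK.
have onto lam (lp : (lam < p)%N) := density_onto_simple (hZ lam lp) (hL lam lp).
have simL lam (lp : (lam < p)%N) : simple_wmod (L lam) by case: (hL lam lp).
have [f1 [hf1 sf1]] := onto _ p1p; rewrite prednK // (pcharf0 hp) in f1 hf1 sf1.
have [f0 [hf0 sf0]] := onto _ p0.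
have [_ _ ses0] := density0_exact (simL _ p1p) hf1 sf1.
have [KT ses1] := density1_exact (simL _ p1p) hf1 sf1 (simL _ p0) hf0 sf0.
have Kmid i : (0 < i < p.-1)%N ->
    K0_class (density hp i.+1%:R) = K0_class (L i).
  move=> /andP[i0 ip]; have ip1 : (i.+1 < p)%N by rewrite -ltn_predRL.
  have [f [hf sf]] := onto i (ltnW ip1).
  apply: (K0_density_simple _ _ _ (simL i _) hf sf) => //.
  - exact: ltn_trans hp3.
  - by rewrite (natr_neq0 hp).
  - by rewrite -natr1 -subr_eq0 addrK (natr_neq0 hp) // i0 ltnW.
  - exact: ltnW.
have part1 : K0_class (tensor (natural k p) (natural k p)) =
    K0_class (L 0%N) *+ 2 + K0_class (L p.-1) *+ 2
      + \sum_(1 <= i < p.-1) K0_class (L i).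
  rewrite (K0_natural_square hp).
  rewrite -(big_mkord xpredT (fun n => K0_class (density hp n%:R))).
  rewrite big_ltn // big_ltn // (K0_class_ses ses0) (K0_class_ses ses1) KT.
  rewrite addrA; congr (_ + _).
    by rewrite !mulr2n [X in _ + X]addrC addrACA.
  rewrite -[X in \sum_(2 <= _ < X) _](prednK p0) big_add1 /=.
  by apply: eq_big_nat => i; exact: Kmid.
split=> //.
move: part1; rewrite natural_density.
rewrite (K0_class_ses (tensor_exactl _ ses0)).
rewrite (K0_class_ses (tensor_exactr (L p.-1) ses0)).
rewrite K0_tensor_triviall K0_tensor_trivialr (K0_class_ses ses0) KT.
have -> : \sum_(0 <= j < p.-1) K0_class (L j) =
    K0_class (L 0%N) + \sum_(1 <= j < p.-1) K0_class (L j).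
  by rewrite big_ltn // ltn_predRL.
set a := K0_class (L 0%N); set b := K0_class (L p.-1); set s := bigop _ _ _.
rewrite addrA => LL; apply: (addrI (a + b + b)); rewrite LL.
by rewrite !mulr2n !addrA [a + b + b + a]addrAC [a + b + a]addrAC.
Qed.
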